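(* Let $R$ be a maximal subring of a ring $T$. Assume that $(R:T)_l=(R:T)=(R:T)_r$, $R$ is a left Artinian ring and $T$ is a zero-dimensional ring. Then $J(R)=J(T)\cap R$.
   Context: All rings are associative and unital (not necessarily commutative), and subrings contain the identity of the big ring. A maximal subring $R$ of $T$ is a proper subring with no subring strictly between $R$ and $T$. Conductors: $(R:T)=\{x\in T: TxT\subseteq R\}$, $(R:T)_l=\{x\in T: Tx\subseteq R\}$, $(R:T)_r=\{x\in T: xT\subseteq R\}$. $J$ is the Jacobson radical. Zero-dimensional refers to classical Krull dimension (supremum of lengths of chains of prime two-sided ideals), i.e. every prime ideal is maximal. *)

(* Defs.v *)
From HB Require Import structures.
From mathcomp Require Import all_boot all_order all_algebra.
From mathcomp Require Import boolp classical_sets.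

Set Implicit Arguments.
Unset Strict Implicit.
Unset Printing Implicit Defensive.

Import GRing.Theory.
Local Open Scope ring_scope.
Local Open Scope classical_set_scope.

(* Subrings and ideals are Prop-valued sets, so no decidability is assumed.
   The ideals of ring_quotient are not used: they are boolean and proper, and
   their notion of primeness is the elementwise (completely prime) one. *)

Section Ideals.
Context {A : pzRingType}.
Implicit Types (I M P : set A).

Definition left_ideal I : Prop :=
  [/\ I 0, forall x y, I x -> I y -> I (x + y) & forall a x, I x -> I (a * x)].

Definition two_sided_ideal I : Prop :=
  left_ideal I /\ forall a x, I x -> I (x * a).

Definition maximal_left_ideal M : Prop :=
  [/\ left_ideal M, M != setT &
      forall I, left_ideal I -> M `<=` I -> I = M \/ I = setT].

(* The condition on x * y says that the product ideal I J lies in P. *)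
Definition prime_ideal P : Prop :=
  [/\ two_sided_ideal P, P != setT &
      forall I J, two_sided_ideal I -> two_sided_ideal J ->
        (forall x y, I x -> J y -> P (x * y)) -> I `<=` P \/ J `<=` P].

End Ideals.

Definition jacobson_radical (A : pzRingType) : set A :=
  [set x | forall M : set A, maximal_left_ideal M -> M x].
Arguments jacobson_radical A : clear implicits.

Definition left_artinian (A : pzRingType) : Prop :=
  forall I : nat -> set A,
    (forall n, left_ideal (I n)) -> (forall n, I n.+1 `<=` I n) ->
    exists N, forall n, (N <= n)%N -> I n = I N.

(* P 0 `<` ... `<` P n, a chain of length n (so of n + 1 primes); the values
   P i for i > n are irrelevant. *)
Definition prime_chain (A : pzRingType) (n : nat) (P : nat -> set A) : Prop :=
  (forall i, (i <= n)%N -> prime_ideal (P i)) /\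
  (forall i, (i < n)%N -> P i `<` P i.+1).

Definition has_krull_dim (A : pzRingType) (d : nat) : Prop :=
  (exists P : nat -> set A, prime_chain d P) /\
  (forall n (P : nat -> set A), prime_chain n P -> (n <= d)%N).

Definition zero_dimensional (A : pzRingType) : Prop := has_krull_dim A 0.

Section Subrings.
Context {T : pzRingType}.
Implicit Types (R S : set T).

Definition is_subring S : Prop := GRing.subring_closed [in S].

Definition maximal_subring R : Prop :=
  [/\ is_subring R, R != setT &
      forall S, is_subring S -> R `<=` S -> S = R \/ S = setT].

Definition conductor R : set T := [set x | forall s t, R (s * x * t)].

Definition left_conductor R : set T := [set x | forall t, R (t * x)].

Definition right_conductor R : set T := [set x | forall t, R (x * t)].

End Subrings.

(* Main.v *)
(** Let J = J(R), which is nilpotent.  The idealizer in T of the right ideal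
    J T contains R, so by maximality it is R or T.  If it is T, then J T is a
    two-sided ideal whose n-th power lies in J^n T, hence it is nilpotent and
    contained in J(T).  If it is R, then J T is contained in R, so J lies in the
    right conductor, which is the two-sided one; for x in J and t in T one then has
    t x t in R, so (x t)^2 = x (t x t) is in J and 1 - x t is left invertible.
    Conversely, an element y of R that is invertible in T is left invertible
    in R, because the chain R y^n stabilises. *)
Require Import Defs.
From HB Require Import structures.
From mathcomp Require Import all_boot all_order all_algebra.
From mathcomp Require Import boolp classical_sets.

Set Implicit Arguments.
Unset Strict Implicit.
Unset Printing Implicit Defensive.

Import GRing.Theory.
Local Open Scope ring_scope.
Local Open Scope classical_set_scope.

Section JacobsonRadical.
Context {A : pzRingType}.
Implicit Types (I L M X Y : set A) (x y z u : A).

(** * Left ideals and maximal left ideals *)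

Lemma left_ideal0 I : left_ideal I -> I 0. Proof. by case. Qed.

Lemma left_idealD I x y : left_ideal I -> I x -> I y -> I (x + y).
Proof. by case=> _ + _; apply. Qed.

Lemma left_idealM I a x : left_ideal I -> I x -> I (a * x).
Proof. by case=> _ _; apply. Qed.

Lemma left_ideal_eqT I : left_ideal I -> I 1 -> I = setT.
Proof.
move=> lI I1; apply/seteqP; split=> // x _.
by rewrite -[x]mulr1; apply: left_idealM.
Qed.

Lemma left_ideal_neqT I : left_ideal I -> I != setT -> ~ I 1.
Proof. by move=> lI /eqP IT /(left_ideal_eqT lI). Qed.

Lemma maximal_left_ideal_exists I :
  left_ideal I -> ~ I 1 -> exists2 M, maximal_left_ideal M & I `<=` M.
Proof.
move=> lI I1.
(* Taking the union with [I] makes the empty set satisfy [P], as Zorn's lemma requires for the empty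
   chain. *)
pose P X := left_ideal (I `|` X) /\ ~ (I `|` X) 1.
have [F FP Ftot|X [[lX X1] Xmax]] := @Zorn_bigcup A P.
  split; last by case=> // -[X FX X1]; case: (FP X FX) => _; apply; right.
  split; first by left; apply: left_ideal0.
  - move=> x y [Ix|[X FX Xx]] [Iy|[Y FY Yy]].
    + by left; apply: left_idealD.
    + have [[_ D _] _] := FP Y FY.
      by case: (D x y (or_introl Ix) (or_intror Yy)) => ?;
        [left | right; exists Y].
    + have [[_ D _] _] := FP X FX.
      by case: (D x y (or_intror Xx) (or_introl Iy)) => ?;
        [left | right; exists X].
    + have [XY|YX] := Ftot X Y FX FY.
        have [[_ D _] _] := FP Y FY.
        by case: (D x y (or_intror (XY _ Xx)) (or_intror Yy)) => ?;
          [left | right; exists Y].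
      have [[_ D _] _] := FP X FX.
      by case: (D x y (or_intror Xx) (or_intror (YX _ Yy))) => ?;
        [left | right; exists X].
  - move=> a x [Ix|[X FX Xx]]; first by left; apply: left_idealM.
    have [[_ _ D] _] := FP X FX.
    by case: (D a x (or_intror Xx)) => ?; [left | right; exists X].
exists (I `|` X); last exact: subsetUl.
split=> //; first by apply/eqP => XT; apply: X1; rewrite XT.
move=> L lL XL; have [L1|L1] := pselect (L 1).
  by right; apply: left_ideal_eqT.
have IL : I `|` L = L by apply/setUidPr => x Ix; apply: XL; left.
left; apply/seteqP; split=> // x Lx; apply: contrapT => Xx.
have PL : P L by rewrite /P IL.
apply: Xmax PL; split=> [y Xy|LX]; first by apply: XL; right.
by apply: Xx; right; apply: LX.
Qed.

(** * The radical through left inverses *)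

Lemma left_ideal_principal x : left_ideal [set z | exists a, z = a * x].
Proof.
split; first by exists 0; rewrite mul0r.
- by move=> _ _ [a ->] [b ->]; exists (a + b); rewrite mulrDl.
- by move=> b _ [a ->]; exists (b * a); rewrite mulrA.
Qed.

(** If [1 - a * x] has no left inverse, some maximal [M] contains it along with [a * x], hence 1.
    Conversely, if [x] is outside [M], then M + A x is everything, so some [1 - a * x] lies in
    [M]. *)
Lemma jacobson_radicalP x :
  jacobson_radical A x <-> forall a, exists u, u * (1 - a * x) = 1.
Proof.
split=> [Jx a|linv M [lM /(left_ideal_neqT lM) M1 maxM]].
  apply: contrapT => ninv.
  have lI := left_ideal_principal (1 - a * x).
  have [|M maxM sub] := maximal_left_ideal_exists lI.
    by case=> u u1; apply: ninv; exists u.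
  have [lM /(left_ideal_neqT lM) M1 _] := maxM.
  apply: M1; rewrite -[1](subrK (a * x)); apply: left_idealD => //.
    by apply: sub; exists 1; rewrite mul1r.
  by apply: left_idealM => //; apply: Jx.
pose L := [set z | exists m a, M m /\ z = m + a * x].
have lL : left_ideal L.
  split; first by exists 0, 0; split; [apply: left_ideal0|rewrite mul0r addr0].
  - move=> _ _ [m [a [Mm ->]]] [n [b [Mn ->]]]; exists (m + n), (a + b).
    by split; [apply: left_idealD|rewrite mulrDl addrACA].
  - move=> c _ [m [a [Mm ->]]]; exists (c * m), (c * a).
    by split; [apply: left_idealM|rewrite mulrDr mulrA].
have [|LM|LT] := maxM L lL.
- by move=> m Mm; exists m, 0; rewrite mul0r addr0.
- rewrite -LM; exists 0, 1; split; first exact: left_ideal0.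
  by rewrite mul1r add0r.
have [m [a [Mm m1]]] : L 1 by rewrite LT.
have [u u1] := linv a.
by case: M1; rewrite -u1 m1 addrK; apply: left_idealM.
Qed.

Lemma left_ideal_jacobson : left_ideal (jacobson_radical A).
Proof.
split=> [M [/left_ideal0]|x y Jx Jy M maxM|a x Jx M maxM] //.
  by have [lM _ _] := maxM; apply: left_idealD; [|apply: Jx|apply: Jy].
by have [lM _ _] := maxM; apply: left_idealM; [|apply: Jx].
Qed.

Lemma linv_subr1M_swap x y :
  (exists u, u * (1 - y * x) = 1) -> exists v, v * (1 - x * y) = 1.
Proof.
(* This works because u y (1 - x y) = u (1 - y x) y = y. *)
case=> u u1; exists (1 + x * u * y).
rewrite mulrDl mul1r -[x * u * y]mulrA -[x * (u * y) * _]mulrA.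
have -> : u * y * (1 - x * y) = y.
  by rewrite -mulrA mulrBr mulr1 mulrA -{1}[y]mul1r -mulrBl mulrA u1 mul1r.
by rewrite subrK.
Qed.

Lemma jacobson_mulr x a : jacobson_radical A x -> jacobson_radical A (x * a).
Proof.
move=> /jacobson_radicalP Jx; apply/jacobson_radicalP => b.
rewrite mulrA; apply: linv_subr1M_swap; rewrite mulrA; exact: Jx.
Qed.

(** Nakayama's lemma for a cyclic module: [1 - a] is left invertible and kills [x]. *)
Lemma subr1_linv_eq0 x a : jacobson_radical A a -> x = a * x -> x = 0.
Proof.
move=> /jacobson_radicalP /(_ 1) [u]; rewrite mul1r => u1 xax.
by rewrite -[x]mul1r -u1 -mulrA mulrBl mul1r -xax subrr mulr0.
Qed.

Lemma jacobson_unit x : jacobson_radical A x ->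
  exists u, u * (1 - x) = 1 /\ (1 - x) * u = 1.
Proof.
move=> Jx; have /jacobson_radicalP/(_ 1)[u] := Jx; rewrite mul1r => u1.
exists u; split=> //.
have /jacobson_radicalP/(_ (- u))[v] := Jx.
(* The left inverse [u] again has the form 1 minus an element of the radical, so it has a left
   inverse too, necessarily [1 - x]. *)
have -> : 1 - (- u) * x = u.
  by move/eqP: u1; rewrite mulNr opprK mulrBr mulr1 subr_eq => /eqP/esym.
by move=> v1; rewrite -[1 - x]mul1r -{1}v1 -[v * u * _]mulrA u1 mulr1.
Qed.

(** * Products of sets and powers of the radical *)

Inductive set_mul X Y : A -> Prop :=
| set_mul0 : set_mul X Y 0
| set_mul_cons x y z : X x -> Y y -> set_mul X Y z -> set_mul X Y (x * y + z).

Lemma set_mul_mem X Y x y : X x -> Y y -> set_mul X Y (x * y).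
Proof. by move=> Xx Yy; rewrite -[x * y]addr0; do 2?constructor. Qed.

Lemma set_mulD X Y y z : set_mul X Y y -> set_mul X Y z -> set_mul X Y (y + z).
Proof.
by elim=> [|a b c Xa Yb _ IH] Zz; rewrite ?add0r -?addrA //; constructor; auto.
Qed.

Lemma set_mul_opp X Y z :
  (forall y, Y y -> Y (- y)) -> set_mul X Y z -> set_mul X Y (- z).
Proof.
move=> YN; elim=> [|x y w Xx Yy _ IH]; first by rewrite oppr0; constructor.
by rewrite opprD -mulrN; constructor; auto.
Qed.

Lemma set_mul_mull X Y a z :
  (forall x, X x -> X (a * x)) -> set_mul X Y z -> set_mul X Y (a * z).
Proof.
move=> aX; elim=> [|x y w Xx Yy _ IH]; first by rewrite mulr0; constructor.
by rewrite mulrDr mulrA; constructor; auto.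
Qed.

Lemma left_ideal_set_mul X Y :
  (forall a x, X x -> X (a * x)) -> left_ideal (set_mul X Y).
Proof.
move=> aX; split; first exact: set_mul0.
  by move=> x y; apply: set_mulD.
by move=> a x; apply: set_mul_mull => y; apply: aX.
Qed.

Fixpoint jacobson_exp n : set A :=
  if n is m.+1 then set_mul (jacobson_radical A) (jacobson_exp m) else setT.

Lemma left_ideal_jacobson_exp n : left_ideal (jacobson_exp n).
Proof.
case: n => [|n]; first by split.
by apply: left_ideal_set_mul => a x; apply: left_idealM left_ideal_jacobson.
Qed.

Lemma jacobson_expS n : jacobson_exp n.+1 `<=` jacobson_exp n.
Proof.
elim: n => // n IH x; elim=> [|j y z Jj Yy _ Zz]; first exact: set_mul0.
by apply: set_mul_cons => //; apply: IH.
Qed.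

Lemma jacobson_exp_sub n : jacobson_exp n.+1 `<=` jacobson_radical A.
Proof.
move=> x; elim=> [|j y z Jj _ _ Jz].
  exact: left_ideal0 left_ideal_jacobson.
by apply: left_idealD left_ideal_jacobson _ Jz; apply: jacobson_mulr.
Qed.

(** Powers grow on the left by definition; this lets them grow on the right. *)
Lemma jacobson_exp_mulr n x j :
  jacobson_exp n x -> jacobson_radical A j -> jacobson_exp n.+1 (x * j).
Proof.
elim: n x => [|n IH] x.
  move=> _ Jj; rewrite -[x * j]mulr1; apply: set_mul_mem => //.
  exact: left_idealM left_ideal_jacobson Jj.
elim=> [|i y z Ji Yy _ IHz] Jj; first by rewrite mul0r; apply: set_mul0.
by rewrite mulrDl -mulrA; apply: set_mul_cons => //; [apply: IH|apply: IHz].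
Qed.

(* Replaces the inclusion of J^(m+n) in J^m J^n. *)
Lemma jacobson_expD_ann m n x :
  (forall a b, jacobson_exp m a -> jacobson_exp n b -> a * b * x = 0) ->
  forall c, jacobson_exp (m + n) c -> c * x = 0.
Proof.
elim: m x n => [|m IH] x n abx c.
  by move=> nc; rewrite -[c]mul1r; apply: abx.
rewrite addSnnS => mnc; apply: (IH x n.+1 _ c mnc) => a b ma.
elim=> {b} [|j b z Jj nb _ IHz]; first by rewrite mulr0 mul0r.
rewrite mulrDr mulrDl IHz addr0 mulrA abx //.
exact: jacobson_exp_mulr.
Qed.

(** * Left Artinian rings *)

Lemma left_artinian_minimal (Q : set (set A)) L0 :
  left_artinian A -> Q `<=` left_ideal -> Q L0 ->
  exists2 L, Q L & forall L', Q L' -> L' `<=` L -> L `<=` L'.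
Proof.
move=> artA Ql QL0; apply: contrapT => nomin.
(* With [Q L] under the existential, choice gives a total function, whose iterates from [L0] descend
   strictly. *)
have step L : exists L', Q L -> [/\ Q L', L' `<=` L & ~ (L `<=` L')].
  have [QL|] := pselect (Q L); last by move=> nQ; exists L => /nQ.
  apply: contrapT => nL; apply: nomin; exists L => // L' QL' sub.
  by apply: contrapT => nsub; apply: nL; exists L'.
have [f fP] := choice step.
have Qf n : Q (iter n f L0) by elim: n => //= n /fP[].
have [n||N NP] := artA (fun n => iter n f L0); first exact: Ql.
  by move=> n; have [] := fP _ (Qf n).
have [_ _ +] := fP _ (Qf N).
by rewrite -iterS NP //; apply.
Qed.

Lemma jacobson_nilpotent :
  left_artinian A -> exists n, jacobson_exp n `<=` [set 0].
Proof.
move=> artA; have [N NP] := artA _ left_ideal_jacobson_exp jacobson_expS.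
exists N => c Nc; apply: contrapT => c0.
(* With N stable and J^N <> 0, a minimal L with J^N L <> 0 equals J^N x for some
   x in L, so x = b x with b in J. *)
pose Q := [set L | left_ideal L /\
             exists a x, [/\ jacobson_exp N a, L x & a * x <> 0]].
have [||L [lL [a [x [Na Lx ax0]]]] minL] := @left_artinian_minimal Q setT artA.
- by move=> L [].
- by split=> //; exists c, 1; rewrite mulr1.
pose Nx := [set z | exists2 b, jacobson_exp N b & z = b * x].
have lN := left_ideal_jacobson_exp N.
have lNx : left_ideal Nx.
  split; first by exists 0; rewrite ?mul0r //; apply: left_ideal0.
  - move=> _ _ [b Nb ->] [d Nd ->]; exists (b + d); last by rewrite mulrDl.
    exact: left_idealD.
  - move=> d _ [b Nb ->]; exists (d * b); last by rewrite mulrA.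
    exact: left_idealM.
have [b Nb xbx] : Nx x; last first.
  apply: ax0; rewrite (subr1_linv_eq0 _ xbx) ?mulr0 //.
  (* As [N] may be 0, [b] is viewed in J^(N+1) = J^N to get it into J. *)
  by apply: (@jacobson_exp_sub N); rewrite NP.
apply: (minL Nx) => //; last by move=> _ [b _ ->]; apply: left_idealM.
split=> //; apply: contrapT => NNx; apply: ax0.
(* If J^N killed J^N x, then J^(2N) = J^N would kill x. *)
apply: (@jacobson_expD_ann N N); last by rewrite NP ?leq_addr.
move=> b d Nb Nd; rewrite -mulrA; apply: contrapT => bdx.
by apply: NNx; exists b, (d * x); split=> //; exists d.
Qed.

Lemma left_artinian_pow x : left_artinian A ->
  exists n u, x ^+ n = u * x ^+ n.+1.
Proof.
move=> artA.
have [||N NP] := artA (fun n => [set z | exists a, z = a * x ^+ n]).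
- by move=> n; apply: left_ideal_principal.
- by move=> n _ [a ->]; exists (a * x); rewrite -mulrA -exprS.
have : [set z | exists a, z = a * x ^+ N] (x ^+ N) by exists 1; rewrite mul1r.
by rewrite -(NP N.+1) // => -[u xu]; exists N, u.
Qed.

Lemma nilpotent_linv x n : x ^+ n = 0 -> exists u, u * (1 - x) = 1.
Proof.
move=> xn0; exists (\sum_(i < n) x ^+ i).
have xS : GRing.comm (1 - x) (\sum_(i < n) x ^+ i).
  apply/commr_sym/commrB; first exact: commr1.
  by apply/commr_sym/commr_sum => i _; apply: commrX.
by rewrite -xS -opprB mulNr -subrX1 xn0 sub0r opprK.
Qed.

End JacobsonRadical.

(** * Comparing the radicals of a ring and a subring *)

Section Subring.
Context {T : pzRingType} {S : {pred T}} {R : subPzRingType S}.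

Lemma val_lift (t : T) : t \in S -> exists r : R, val r = t.
Proof. by move=> St; exists (Sub t St); rewrite SubK. Qed.

Lemma jacobson_capr (r : R) : left_artinian R ->
  jacobson_radical T (val r) -> jacobson_radical R r.
Proof.
move=> artR Jr; apply/jacobson_radicalP => a.
have [n [u yn]] := left_artinian_pow (1 - a * r) artR.
exists u; apply: val_inj; set y := 1 - a * r in yn *.
have [v [v1 v2]] : exists v, v * val y = 1 /\ val y * v = 1.
  rewrite rmorphB rmorph1 rmorphM; apply: jacobson_unit.
  exact: left_idealM left_ideal_jacobson Jr.
have yvn : val y ^+ n * v ^+ n = 1.
  by rewrite -exprMn_comm ?v2 ?expr1n // /GRing.comm v1 v2.
(* Cancelling y^n in T leaves 1 = u y, where [u] already lies in [R]. *)
have := congr1 (fun z => val z * v ^+ n) yn.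
by rewrite /= exprS !(rmorphM, rmorphXn) -!mulrA yvn mulr1 rmorph1 => <-.
Qed.

Let K n : set T := set_mul (val @` @jacobson_exp R n) setT.
Let JT : set T := set_mul (val @` jacobson_radical R) setT.

(** For p in J(R)^n, the product p t w lies in p J(R) T, since t w is in J(R) T; so each factor w
    raises the exponent by one. *)
Lemma jacobson_span_pow (w : T) n :
  (forall t, JT (t * w)) -> K n (w ^+ n).
Proof.
move=> Kw; elim: n => [|n].
  rewrite expr0 -[1]mulr1; apply: set_mul_mem => //.
  by exists 1; rewrite ?rmorph1.
rewrite exprSr; elim=> [|_ t z [p np <-] _ _ IH].
  by rewrite mul0r; apply: set_mul0.
rewrite mulrDl -mulrA; apply: set_mulD IH.
elim: (Kw t) => [|_ s y [j Jj <-] _ _ IH].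
  by rewrite mulr0; apply: set_mul0.
rewrite mulrDr mulrA -rmorphM; apply: set_mul_cons IH => //.
by exists (p * j) => //; apply: jacobson_exp_mulr.
Qed.

Lemma jacobson_span_ideal_sub (r : R) : left_artinian R ->
  (forall t z, JT z -> JT (t * z)) ->
  jacobson_radical R r -> jacobson_radical T (val r).
Proof.
move=> artR Kl Jr; apply/jacobson_radicalP => t.
have [n n0] := jacobson_nilpotent artR.
have Kr : JT (val r) by rewrite -[val r]mulr1; apply: set_mul_mem => //; exists r.
apply: (@nilpotent_linv _ _ n).
have : K n ((t * val r) ^+ n).
  by apply: jacobson_span_pow => s; exact: (Kl _ _ (Kl _ _ Kr)).
elim=> // _ s z [p /n0 -> <-] _ _ ->.
by rewrite rmorph0 mul0r addr0.
Qed.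

Lemma jacobson_conductor_sub (r : R) : conductor [set` S] (val r) ->
  jacobson_radical R r -> jacobson_radical T (val r).
Proof.
move=> Cr Jr; apply/jacobson_radicalP => t; apply: linv_subr1M_swap.
have [s sE] : exists s : R, val s = t * val r * t by apply/val_lift/Cr.
have /jacobson_radicalP/(_ 1)[u] := jacobson_mulr s Jr; rewrite mul1r => u1.
(* [u] inverts 1 - r s = 1 - (r t)^2 = (1 + r t)(1 - r t) on the left. *)
exists (val u * (1 + val r * t)).
transitivity (val (u * (1 - r * s))); last by rewrite u1 rmorph1.
rewrite rmorphM rmorphB rmorph1 rmorphM /= sE -mulrA; congr (_ * _).
by rewrite mulrDl mul1r mulrBr mulr1 addrA subrK !mulrA.
Qed.

(** [R] multiplies J(R) T into itself because J(R) is a left ideal of [R]. *)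
Lemma jacobson_span_idealizer :
  let I := [set x | forall z, JT z -> JT (x * z)] in
  is_subring I /\ [set` S] `<=` I.
Proof.
split; first split.
- by rewrite inE => z; rewrite mul1r.
- move=> x y; rewrite !inE => Ix Iy z Kz; rewrite mulrBl.
  by apply: set_mulD; [apply: Ix|apply: set_mul_opp => //; apply: Iy].
- move=> x y; rewrite !inE => Ix Iy z Kz; rewrite -mulrA.
  by apply: Ix; apply: Iy.
move=> x /= /val_lift[r <-] z; apply: set_mul_mull => _ [j Jj <-].
rewrite -rmorphM; exists (r * j) => //.
exact: left_idealM left_ideal_jacobson Jj.
Qed.

Lemma jacobson_sub (r : R) : maximal_subring [set` S] ->
  conductor [set` S] = right_conductor [set` S] -> left_artinian R ->
  jacobson_radical R r -> jacobson_radical T (val r).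
Proof.
case=> _ _ maxS condr artR Jr.
have [subI SI] := jacobson_span_idealizer.
have [IS|IT] := maxS _ subI SI.
  apply: jacobson_conductor_sub => //; rewrite condr => t.
  (* r (t z) is in J(R) T for every z, so r t is in the idealizer, here equal to [S]. *)
  rewrite -IS => z _; rewrite -mulrA; apply: set_mul_mem => //.
  by exists r.
apply: jacobson_span_ideal_sub => // t z.
by have : [set: T] t by []; rewrite -IT; apply.
Qed.

End Subring.

(* R is a ring carried by the subset S of T, with inclusion val : R -> T. *)
Theorem proposition4p8 (T : pzRingType) (S : {pred T}) (R : subPzRingType S)
    (maxR : maximal_subring [set` S])
    (condl : left_conductor [set` S] = conductor [set` S])
    (condr : conductor [set` S] = right_conductor [set` S])
    (artR : left_artinian R)
    (dimT : zero_dimensional T) :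
  [set val x | x in jacobson_radical R] = jacobson_radical T `&` [set` S].
Proof.
apply/seteqP; split=> [_ [r Jr <-]|x [Jx /= /val_lift-/(_ R)[r rx]]].
  by split; [apply: jacobson_sub|apply: valP].
by exists r => //; apply: jacobson_capr; rewrite ?rx.
Qed.
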